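(* Let $G$ be a connected graph of order $n\ge 2$. Then $\operatorname{th}^\ast(G)$ is the least $k$ such that $\operatorname{pt}(G,k)=1$, i.e., $\operatorname{th}^\ast(G)=k(G,1)$. Necessarily $k(G,1)\ge \frac n2$.
   Context: All graphs are finite, simple and undirected. Standard zero forcing: each vertex is blue or white; if $w$ is the unique white neighbor of a blue vertex $v$, then $v$ can force $w$ (change $w$ to blue). For a nonempty set $S\subseteq V(G)$ of initially blue vertices, set $S^{[0]}=S^{(0)}=S$, let $S^{(i+1)}$ be the set of white vertices that can be forced by some vertex when exactly the vertices of $S^{[i]}$ are blue, and let $S^{[i+1]}=S^{[i]}\cup S^{(i+1)}$. The set $S$ is a zero forcing set if $S^{[p]}=V(G)$ for some $p$; then the propagation time $\operatorname{pt}(G;S)$ is the least such $p\ge 0$. If $S$ is not a zero forcing set, $\operatorname{pt}(G;S)=\infty$. The zero forcing number $\operatorname{Z}(G)$ is the minimum cardinality of a zero forcing set. For a positive integer $k$, $\operatorname{pt}(G,k)=\min_{|S|=k}\operatorname{pt}(G;S)$. Define $k(G,p)=\min\{|S|:\operatorname{pt}(G;S)=p\}$. The no initial cost product throttling number for standard zero forcing of a connected graph $G$ of order $n\ge 2$ is $\operatorname{th}^\ast(G)=\min_{\operatorname{Z}(G)\le k<n}k\operatorname{pt}(G,k)$. *)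

(* Defs.v *)
From HB Require Import structures.
From mathcomp Require Import all_boot boolp.

Set Implicit Arguments.
Unset Strict Implicit.
Unset Printing Implicit Defensive.

(* Natural numbers extended with infinity, which is represented by [None]. *)
Definition enat := option nat.

Definition emin (x y : enat) : enat :=
  match x, y with
  | Some m, Some n => Some (minn m n)
  | Some m, None => Some m
  | None, _ => y
  end.

Lemma eminA : associative emin.
Proof. by case=> [a|] [b|] [c|] //=; rewrite minnA. Qed.

Lemma eminC : commutative emin.
Proof. by case=> [a|] [b|] //=; rewrite minnC. Qed.

Lemma emin0 : left_id None emin.
Proof. by case. Qed.

(* Makes [\big[emin/None]] a minimum that does not depend on the order of
   enumeration and is infinite on an empty range. *)
HB.instance Definition _ := Monoid.isComLaw.Build enat None emin
  eminA eminC emin0.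

(* [k * x], used for [k > 0] only, so that an infinite [x] gives infinity. *)
Definition emuln (k : nat) (x : enat) : enat := omap (muln k) x.

Section ZeroForcing.
Variables (T : finType) (e : rel T).

(* A vertex [v] whose white neighbours are exactly [w] forces [w]; in
   particular [w] is white. *)
Definition forced (B : {set T}) : {set T} :=
  [set w | [exists v in B, [set u | e v u & u \notin B] == [set w]]].

(* [blue S i] is S^[i]; the set S^(i+1) is [forced (blue S i)]. *)
Fixpoint blue (S : {set T}) (i : nat) : {set T} :=
  if i is i'.+1 then blue S i' :|: forced (blue S i') else S.

(* In a graph with at least one vertex, the empty set is not zero forcing, so
   restricting to nonempty [S] is automatic. *)
Definition zero_forcing (S : {set T}) : Prop := exists p, blue S p == setT.

Definition zero_forcing_number : nat :=
  #|[arg min_(S < setT | `[< zero_forcing S >]) #|S|]|.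

Definition pt (S : {set T}) : enat :=
  match pselect (zero_forcing S) with
  | left zS => Some (ex_minn zS)
  | right _ => None
  end.

Definition pt_card (k : nat) : enat :=
  \big[emin/None]_(S : {set T} | #|S| == k) pt S.

(* k(G,p) *)
Definition min_card_pt (p : nat) : enat :=
  \big[emin/None]_(S : {set T} | pt S == Some p) Some #|S|.

(* th^*(G) *)
Definition throttling_star : enat :=
  \big[emin/None]_(zero_forcing_number <= k < #|T|) emuln k (pt_card k).

End ZeroForcing.

(* Main.v *)
Require Import Defs.
From mathcomp Require Import all_boot boolp.

(** If [S] propagates in [p >= 1] steps, then [S^[p-1]] propagates in one step.
Each step forces at most [#|S|] vertices, so [S^[p-1]] has at most [#|S| * p]
vertices: trading the whole propagation for its last step never increases the
product cost. *)

Set Implicit Arguments.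
Unset Strict Implicit.
Unset Printing Implicit Defensive.

Section BigEmin.
Variables (I : eqType) (r : seq I) (P : pred I) (F : I -> enat).

Lemma big_emin_attained (m : nat) :
  \big[emin/None]_(i <- r | P i) F i = Some m ->
  exists i, [/\ i \in r, P i & F i = Some m].
Proof.
elim: r m => [|j s IHs] m; first by rewrite big_nil.
have IH l : \big[emin/None]_(i <- s | P i) F i = Some l ->
    exists i, [/\ i \in j :: s, P i & F i = Some l].
  by case/IHs=> i [si Pi Fi]; exists i; rewrite inE si orbT.
rewrite big_cons; case: ifP => [Pj|_]; last exact: IH.
case Fj: (F j) => [a|]; last exact: IH.
have j_attains : exists i, [/\ i \in j :: s, P i & F i = Some a].
  by exists j; rewrite inE eqxx.
case Es: (\big[emin/None]_(i <- s | P i) F i) => [b|] /= [<-] //.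
by case: (leqP a b) => // _; apply: IH.
Qed.

Lemma big_emin_le (i : I) (x : nat) : i \in r -> P i -> F i = Some x ->
  exists2 m, \big[emin/None]_(j <- r | P j) F j = Some m & m <= x.
Proof.
move=> ri Pi Fi; rewrite (big_rem i) //= Pi Fi.
case: (\big[emin/None]_(_ <- _ | _) _) => [b|] /=; last by exists x.
by exists (minn x b) => //; apply: geq_minl.
Qed.

(** Reduces a finite minimum to a witness and a lower bound; infinite terms need no bound. *)
Lemma big_eminP (m : nat) :
  \big[emin/None]_(i <- r | P i) F i = Some m <->
  (exists i, [/\ i \in r, P i & F i = Some m]) /\
  (forall i x, i \in r -> P i -> F i = Some x -> m <= x).
Proof.
split=> [Em | [[i [ri Pi Fi]] lb]].
  split=> [|i x ri Pi Fi]; first exact: big_emin_attained.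
  by have [l] := big_emin_le ri Pi Fi; rewrite Em => -[->].
have [l El le_lm] := big_emin_le ri Pi Fi.
have [j [rj Pj Fj]] := big_emin_attained El.
by rewrite El; congr Some; apply/eqP; rewrite eqn_leq le_lm (lb _ _ rj Pj Fj).
Qed.

End BigEmin.

Section Propagation.
Variables (T : finType) (e : rel T).
Implicit Types S B : {set T}.

(** The blue vertices that may still force, now or later. Their number never grows, which is what
    bounds every step by the initial [#|S|]. *)
Definition active B : {set T} :=
  [set v in B | [exists u, e v u && (u \notin B)]].

Definition forcers B : {set T} :=
  [set v in B | #|[set u | e v u & u \notin B]| == 1].

Lemma forcers_sub_active B : forcers B \subset active B.
Proof.
apply/subsetP=> v; rewrite !inE => /andP[-> /cards1P[w Ew]] /=.
by apply/existsP; exists w; move/setP/(_ w): Ew; rewrite !inE eqxx.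
Qed.

(** A forcer has a single white neighbour, so distinct forced vertices need distinct forcers: each
    singleton of a forced vertex is the white neighbourhood of some forcer. *)
Lemma card_forced_le_forcers B : #|forced e B| <= #|forcers B|.
Proof.
pose white v := [set u | e v u & u \notin B].
rewrite -(card_imset _ set1_inj).
apply: leq_trans (leq_imset_card white (forcers B)).
apply/subset_leq_card/subsetP=> _ /imsetP[w wB ->].
move: wB; rewrite inE => /exists_inP[v vB /eqP Ev].
by apply/imsetP; exists v; rewrite // inE vB Ev cards1.
Qed.

(** White neighbours are only lost over time, so an old vertex active after the step was active
    before it, and a forcer has just lost its last one. *)
Lemma active_step B :
  active (B :|: forced e B) \subset (active B :\: forcers B) :|: forced e B.
Proof.
apply/subsetP=> v; rewrite in_setU in_setD [v \in active _]inE in_setU.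
case/andP=> vBF /existsP[u /andP[evu]]; rewrite in_setU negb_or.
case/andP=> uB uF; case: (boolP (v \in forced e B)) vBF => [_ _|_].
  by rewrite orbT.
rewrite !orbF => vB; apply/andP; split; last first.
  by rewrite inE vB; apply/existsP; exists u; rewrite evu.
(* If [v] were a forcer, [u] would be its only white neighbour and would have been forced. *)
apply: contra uF; rewrite inE vB => /cards1P[w Ew].
have /setP/(_ u) := Ew; rewrite !inE evu uB => /esym/eqP ->.
by apply/exists_inP; exists v => //; rewrite Ew.
Qed.

(** At least as many forcers retire as forced vertices join. *)
Lemma card_active_step B : #|active (B :|: forced e B)| <= #|active B|.
Proof.
apply: leq_trans (subset_leq_card (active_step B)) _.
apply: leq_trans (leq_card_setU _ _) _.
rewrite -(cardsID (forcers B) (active B)) addnC leq_add2r.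
by rewrite (setIidPr (forcers_sub_active B)) card_forced_le_forcers.
Qed.

Lemma card_active_blue S i : #|active (blue e S i)| <= #|S|.
Proof.
elim: i => [|i IHi] /=.
  by apply/subset_leq_card/subsetP=> v; rewrite inE => /andP[].
exact: leq_trans (card_active_step _) IHi.
Qed.

(** The factor [i.+1] counts [S] itself and [i] steps, each adding at most [#|S|] vertices. *)
Lemma card_blue S i : #|blue e S i| <= #|S| * i.+1.
Proof.
elim: i => [|i IHi]; first by rewrite muln1.
rewrite mulnS addnC; apply: leq_trans (leq_card_setU _ _) _.
apply: leq_add => //; apply: leq_trans (card_forced_le_forcers _) _.
apply: leq_trans (card_active_blue S i).
exact: subset_leq_card (forcers_sub_active _).
Qed.

Lemma ptP S p : pt e S = Some p <->
  blue e S p = setT /\ (forall q, blue e S q = setT -> p <= q).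
Proof.
rewrite /pt; case: pselect => [zS|nzS]; last first.
  by split=> // -[Sp _]; case: nzS; exists p; apply/eqP.
case: ex_minnP => m /eqP Sm min_m; split=> [[<-]|[Sp min_p]].
  by split=> // q /eqP; apply: min_m.
by congr Some; apply/eqP; rewrite eqn_leq min_p // min_m // Sp.
Qed.

Lemma pt_zero_forcing S p : pt e S = Some p -> zero_forcing e S.
Proof. by case/ptP=> Sp _; exists p; apply/eqP. Qed.

Lemma pt_eq0 S : pt e S = Some 0 -> S = setT.
Proof. by case/ptP. Qed.

Lemma pt1P S : pt e S = Some 1 <-> blue e S 1 = setT /\ S != setT.
Proof.
split=> [/ptP[S1 min1]|[S1 /eqP nS]].
  by split=> //; apply/eqP=> ST; have := min1 0 ST.
by apply/ptP; split=> // -[|q].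
Qed.

Lemma pt_last_step S p : pt e S = Some p.+1 -> pt e (blue e S p) = Some 1.
Proof.
case/ptP=> Sp min_p; apply/pt1P; split=> //.
by apply/eqP=> /min_p; rewrite ltnn.
Qed.

Lemma pt1_card S : pt e S = Some 1 -> #|T| <= 2 * #|S|.
Proof. by case/pt1P=> S1 _; have := card_blue S 1; rewrite S1 cardsT mulnC. Qed.

Lemma pt1_card_lt S : pt e S = Some 1 -> #|S| < #|T|.
Proof. by case/pt1P=> _; rewrite -cardsT -properT => /proper_card. Qed.

(** Here [x] forces [y], the only white vertex. An edge thus makes k(G,1) finite. *)
Lemma pt1_setC1 x y : e x y -> x != y -> pt e [set~ y] = Some 1.
Proof.
move=> exy nxy; apply/pt1P; split; last first.
  by apply/eqP=> /setP/(_ y); rewrite !inE eqxx.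
apply/setP=> z; rewrite !inE; case: eqVneq => //= ->.
apply/exists_inP; exists x; first by rewrite !inE.
apply/eqP/setP=> u; rewrite !inE negbK andbC.
by case: eqVneq => //= ->.
Qed.

Lemma pt_card_attained k p : pt_card e k = Some p ->
  exists2 S : {set T}, #|S| = k & pt e S = Some p.
Proof. by case/big_emin_attained=> S [_ /eqP Sk Sp]; exists S. Qed.

Lemma zero_forcing_number_le S :
  zero_forcing e S -> zero_forcing_number e <= #|S|.
Proof.
rewrite /zero_forcing_number; case: arg_minnP => [|B _ minB zS].
  (* The default candidate [setT] is zero forcing in 0 steps. *)
  by apply/asboolP; exists 0.
by apply: minB; apply/asboolP.
Qed.

End Propagation.

Lemma connected_has_edge (T : finType) (e : rel T) :
  irreflexive e -> (forall x y : T, connect e x y) -> 2 <= #|T| ->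
  exists x y, e x y && (x != y).
Proof.
move=> e_irr e_conn /card_gt1P[x [z [_ _ nxz]]].
have /connectP[[|y s] /= pth zE] := e_conn x z; first by rewrite zE eqxx in nxz.
case/andP: pth => exy _; exists x, y; rewrite exy /=.
by apply: contraTneq exy => ->; rewrite e_irr.
Qed.

Theorem theorem5p3 (T : finType) (e : rel T)
    (e_sym : symmetric e) (e_irr : irreflexive e)
    (e_conn : forall x y : T, connect e x y) (T_ge2 : 2 <= #|T|) :
  exists k : nat,
    [/\ throttling_star e = Some k,
        0 < k /\ pt_card e k = Some 1,
        forall j : nat, 0 < j -> pt_card e j = Some 1 -> k <= j,
        min_card_pt e 1 = Some k
      & #|T| <= 2 * k].
Proof.
have [x [y /andP[exy nxy]]] := connected_has_edge e_irr e_conn T_ge2.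
have [k Ek _] : exists2 k, min_card_pt e 1 = Some k & k <= #|[set~ y]|.
  apply: big_emin_le (mem_index_enum _) _ erefl.
  by apply/eqP; apply: pt1_setC1 exy nxy.
have [[S [_ /eqP S1 [Sk]]] min_k] := (big_eminP _ _ _ _).1 Ek.
have k_le (B : {set T}) : pt e B = Some 1 -> k <= #|B|.
  by move/eqP=> B1; apply: min_k B1 erefl; apply: mem_index_enum.
have T_le : #|T| <= 2 * k by rewrite -Sk (pt1_card S1).
have k_lt : k < #|T| by rewrite -Sk (pt1_card_lt S1).
have pt_gt0 (B : {set T}) p : #|B| < #|T| -> pt e B = Some p -> 0 < p.
  by case: p => // ltB /pt_eq0 BT; rewrite BT cardsT ltnn in ltB.
(* Propagation time 0 would require all vertices to be blue at the start, but [k < #|T|]. *)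
have ptk : pt_card e k = Some 1.
  apply/big_eminP; split.
    by exists S; rewrite mem_index_enum Sk eqxx.
  by move=> B p _ /eqP Bk; apply: pt_gt0; rewrite Bk.
exists k; split=> //.
- apply/big_eminP; split.
    (* The value is attained at [k] itself, with cost [k * 1]. *)
    exists k; rewrite mem_index_iota ptk /= muln1 k_lt andbT; split=> //.
    by rewrite -Sk; apply/zero_forcing_number_le/(pt_zero_forcing S1).
  move=> j c; rewrite mem_index_iota => /andP[_ j_lt] _.
  case Ej: (pt_card e j) => [p|] //= [<-].
  have [B Bj Bp] := pt_card_attained Ej.
  have p_gt0 : 0 < p by apply: pt_gt0 Bp; rewrite Bj.
  case: p p_gt0 Bp {Ej} => // p _ Bp.
  (* With propagation time [p.+1], the set [blue e B p] finishes in one step, so its size lies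
     between [k] and the cost [#|B| * p.+1]. *)
  by rewrite -Bj; apply: leq_trans (k_le _ (pt_last_step Bp)) (card_blue _ _ _).
- by split=> //; case: (k) T_le => //; rewrite muln0 leqNgt (ltnW T_ge2).
- by move=> j _ /pt_card_attained[B <-]; apply: k_le.
Qed.
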